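(* The functor $\ell^2 \colon \mathbf{PInj} \to \mathbf{Hilb}$ preserves daggers: for every partial injection $f \colon X \to Y$, one has $\ell^2(f^\dag) = (\ell^2 f)^\dag$, that is, $\langle (\ell^2 f)(\varphi) | \psi \rangle = \langle \varphi | \ell^2(f^\dag)(\psi)\rangle$ for all $\varphi \in \ell^2(X)$ and $\psi \in \ell^2(Y)$.
   Context: $\mathbf{Hilb}$ is the category whose objects are complex Hilbert spaces and whose morphisms are continuous linear functions; its dagger sends a morphism to its adjoint. $\mathbf{PInj}$ is the category whose objects are sets and whose morphisms $X \to Y$ are partial injections, i.e. partial functions that are injective on their domain of definition, composed as relations; its dagger sends a partial injection $f \colon X \to Y$ to its converse relation $f^\dag \colon Y \to X$. The functor $\ell^2 \colon \mathbf{PInj} \to \mathbf{Hilb}$ sends a set $X$ to $\ell^2(X) = \{\varphi \colon X \to \mathbb{C} \mid \sum_{x\in X} |\varphi(x)|^2 < \infty\}$ with inner product $\langle \varphi | \psi\rangle = \sum_{x \in X} \overline{\varphi(x)}\psi(x)$, and sends a partial injection $f \colon X \to Y$ to the linear map $\ell^2 f \colon \ell^2(X) \to \ell^2(Y)$ with $(\ell^2 f)(\varphi)(y) = \varphi(x)$ if there is a (necessarily unique) $x$ in the domain of definition of $f$ with $f(x) = y$, and $(\ell^2 f)(\varphi)(y) = 0$ otherwise. *)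

(* Defs.v *)
From HB Require Import structures.
From mathcomp Require Import all_boot all_order all_algebra.
From mathcomp Require Import finmap complex.
From mathcomp Require Import all_classical all_reals all_analysis.
From mathcomp Require Import ring lra.
From mathcomp.analysis.showcase Require Import summability.

Set Implicit Arguments.
Unset Strict Implicit.
Unset Printing Implicit Defensive.

Import Order.TTheory GRing.Theory Num.Theory.
Import numFieldNormedType.Exports.

Local Open Scope classical_set_scope.
Local Open Scope complex_scope.
Local Open Scope ring_scope.

(* Cauchy-Schwarz for an inner product on a space of arbitrary dimension; the  *)
(* lemmas of sesquilinear require a vectType.                                  *)
Section InnerProduct.
Variables (C : numClosedFieldType) (V : lmodType C) (dot : V -> V -> C).
Hypothesis dotP : forall u a v w, dot u (a *: v + w) = a * dot u v + dot u w.
Hypothesis dotC : forall u v, dot v u = (dot u v)^*.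
Hypothesis dot_ge0 : forall u, 0 <= dot u u.

Lemma ipD u v w : dot u (v + w) = dot u v + dot u w.
Proof. by rewrite -[v]scale1r dotP mul1r scale1r. Qed.

Lemma ip0 u : dot u 0 = 0.
Proof. by apply: (addrI (dot u 0)); rewrite -ipD !addr0. Qed.

Lemma ipZ u a v : dot u (a *: v) = a * dot u v.
Proof. by rewrite -[_ *: _]addr0 dotP ip0 addr0. Qed.

Lemma ipN u v : dot u (- v) = - dot u v.
Proof. by rewrite -scaleN1r ipZ mulN1r. Qed.

Lemma ipDl u v w : dot (v + w) u = dot v u + dot w u.
Proof. by rewrite dotC ipD rmorphD /= -!dotC. Qed.

Lemma ipZl u a v : dot (a *: v) u = a^* * dot v u.
Proof. by rewrite dotC ipZ rmorphM /= -dotC. Qed.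

Lemma ipNl u v : dot (- v) u = - dot v u.
Proof. by rewrite dotC ipN rmorphN /= -dotC. Qed.

Lemma ip0l u : dot 0 u = 0.
Proof. by rewrite dotC ip0 rmorph0. Qed.

Lemma ip_sqD u v t : dot (u + t *: v) (u + t *: v) =
  dot u u + (t * dot u v + (t * dot u v)^*) + t * t^* * dot v v.
Proof.
rewrite ipD !ipDl !ipZ !ipZl [dot v u]dotC rmorphM /=; ring.
Qed.

Lemma ip_CS u v : `|dot u v| ^+ 2 <= dot u u * dot v v.
Proof.
have key w z : dot z z != 0 -> `|dot w z| ^+ 2 <= dot w w * dot z z.
  move=> z0; have zp : 0 < dot z z by rewrite lt_neqAle eq_sym z0 dot_ge0.
  have cz : (dot z z)^* = dot z z by rewrite -dotC.
  have := dot_ge0 (w + (- ((dot w z)^* / dot z z)) *: z).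
  rewrite ip_sqD !(rmorphN, rmorphM) /= conjCK fmorphV /= cz.
  rewrite -(pmulr_rge0 _ zp).
  set d := dot w z; set q := dot z z; set p := dot w w.
  rewrite [X in 0 <= X -> _](_ : _ = p * q - d * d^*); last first.
    by rewrite -/q in z0 *; field.
  by rewrite -normCK subr_ge0.
have [v0|/key //] := eqVneq (dot v v) 0.
have [u0|u0] := eqVneq (dot u u) 0; last first.
  by have := key v u u0; rewrite dotC norm_conjC mulrC.
have := dot_ge0 (u + (- (dot u v)^*) *: v).
rewrite ip_sqD v0 u0 !mulr0 addr0 add0r mulNr mulrC -normCK.
rewrite rmorphN /= rmorphXn /= conj_normC.
by rewrite -opprD oppr_ge0 -mulr2n pmulrn_lle0.
Qed.

Lemma ip_triangle u v :
  sqrtC (dot (u + v) (u + v)) <= sqrtC (dot u u) + sqrtC (dot v v).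
Proof.
have s0 w : 0 <= sqrtC (dot w w) by rewrite sqrtC_ge0.
rewrite -ler_sqr ?nnegrE ?addr_ge0 // sqrrD !sqrtCK.
have := ip_sqD u v 1; rewrite scale1r conjC1 !mul1r => ->.
rewrite lerD2r lerD2l.
have h : `|dot u v| <= sqrtC (dot u u) * sqrtC (dot v v).
  by rewrite -ler_sqr ?nnegrE ?mulr_ge0 // exprMn !sqrtCK ip_CS.
have -> : dot u v + (dot u v)^* = 'Re (dot u v) *+ 2.
  by rewrite ReE -mulr_natr divfK ?pnatr_eq0.
rewrite lerMn2r /=; apply: le_trans h.
by have [] := leif_Re_Creal (dot u v).
Qed.

Lemma ip_normZ a u : sqrtC (dot (a *: u) (a *: u)) = `|a| * sqrtC (dot u u).
Proof.
by rewrite ipZ ipZl mulrA -normCK sqrtCM ?nnegrE ?exprn_ge0 // sqrCK.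
Qed.

End InnerProduct.

Section ComplexComplete.
Variable R : realType.

Lemma gt0_complex (e : R[i]) : 0 < e -> exists2 r : R, 0 < r & e = r%:C.
Proof.
case: e => a b; rewrite ltcE /= => /andP[/eqP b0 a0].
by exists a => //; rewrite b0.
Qed.

Lemma norm_le_ReIm (z : R[i]) : `|z| <= (`|complex.Re z| + `|complex.Im z|)%:C.
Proof.
rewrite {1}[z]complexE (le_trans (ler_normD _ _)) // normrM.
have n1 : `|'i%C : R[i]| = 1 by rewrite normc_def /= expr0n add0r expr1n sqrtr1.
by rewrite n1 mul1r rmorphD /= !normc_def /= !expr0n /= !addr0 !sqrtr_sqr lexx.
Qed.

Lemma norm_ge_Im (z : R[i]) : `|complex.Im z|%:C <= `|z|.
Proof.
rewrite normc_def lecR -sqrtr_sqr ler_sqrt ?sqr_ge0 ?addr_ge0 ?sqr_ge0 //.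
by rewrite lerDr sqr_ge0.
Qed.

Lemma complex_complete (F : set_system R[i]^o) :
  ProperFilter F -> cauchy F -> cvg F.
Proof.
move=> FF /cauchyP Fc.
have cauchyRI (h : R[i] -> R) : (forall x y, h (x - y) = h x - h y) ->
    (forall z, `|h z|%:C <= `|z|) -> cvg (h @ F).
  move=> hB hn; apply: R_complete; apply/cauchyP => e e0.
  have [z Fz] := Fc e%:C ltac:(by rewrite ltcR).
  exists (h z); suff : F (h @^-1` ball (h z) e) by [].
  apply: filterS Fz => w /=.
  rewrite -!ball_normE /ball_ /= => zw.
  by rewrite -hB -ltcR (le_lt_trans (hn _)).
have cRe := @cauchyRI (@complex.Re R) ltac:(by case=> ? ? [? ?]) (@normc_ge_Re R).
have cIm := @cauchyRI (@complex.Im R) ltac:(by case=> ? ? [? ?]) norm_ge_Im.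
apply/cvg_ex; exists (Complex (lim (@complex.Re R @ F)) (lim (@complex.Im R @ F))).
apply/(@cvgrPdist_le _ _ _ F _ id) => e /gt0_complex[r r0 ->].
have r2 : 0 < r / 2 by rewrite divr_gt0.
have HR := cvgr_dist_le _ _ cRe _ r2; have HI := cvgr_dist_le _ _ cIm _ r2.
near=> z; apply: (le_trans (norm_le_ReIm _)).
rewrite lecR [r]splitr lerD //.
- have -> : forall a b, complex.Re (Complex a b - z) = a - complex.Re z by move=> ? ?; case: (z).
  by near: z; exact: HR.
- have -> : forall a b, complex.Im (Complex a b - z) = b - complex.Im z by move=> ? ?; case: (z).
  by near: z; exact: HI.
Unshelve. all: by end_near. Qed.

End ComplexComplete.

Section UnorderedSums.
Variables (R : realType) (X : choiceType).
#[local] Existing Instance totally_filter.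
Implicit Types (g : X -> R) (z : X -> R[i]^o) (s : seq X).

Definition fin_bounded g (M : R) := forall s, uniq s -> \sum_(x <- s) g x <= M.

Lemma partial_sumE (V : zmodType) (f : X -> V) (A : {fset X}) :
  partial_sum f A = \sum_(x <- A) f x.
Proof. by rewrite big_seq_fsetE. Qed.

Lemma sum_fsetD (V : zmodType) (f : X -> V) (A B : {fset X}) :
  (A `<=` B)%fset ->
  \sum_(x <- B) f x = \sum_(x <- A) f x + \sum_(x <- (B `\` A)%fset) f x.
Proof.
move=> AB; rewrite (big_fsetID _ (mem A)) /=; congr (_ + _).
  by congr (\sum_(x <- enum_fset _) _); apply/fsetP => x; rewrite !inE /=;
    case: (boolP (x \in A)) => [/(fsubsetP AB) ->|_]; rewrite ?andbF.
congr (\sum_(x <- enum_fset _) _); apply/fsetP => x.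
by rewrite !inE /= andbC.
Qed.

Lemma esum_fin_bounded g : (forall x, 0 <= g x) ->
  (\esum_(x in [set: X]) (g x)%:E < +oo)%E <-> exists M, fin_bounded g M.
Proof.
move=> g0; split=> [h|[M hM]].
  have ge0 : (0 <= \esum_(x in [set: X]) (g x)%:E)%E.
    by apply: esum_ge0 => x _; rewrite lee_fin.
  exists (fine (\esum_(x in [set: X]) (g x)%:E)) => s us.
  rewrite -lee_fin fineK ?ge0_fin_numE // -sumEFin fsbig_seq //.
  by apply: ereal_sup_ubound; exists [set` s] => //; split=> //; exact: finite_seq.
apply: (le_lt_trans (y := M%:E)); last exact: ltry.
apply: ge_ereal_sup => _ [A [fA _] <-].
by rewrite fsbig_finite //= sumEFin lee_fin hM.
Qed.

Lemma fin_bounded_sum g M : (forall x, 0 <= g x) -> fin_bounded g M ->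
  exists S : R,
    [/\ (partial_sum (fun x => (g x)%:C : R[i]^o) @ totally --> (S%:C : R[i]^o)),
        fin_bounded g S & forall M', fin_bounded g M' -> S <= M'].
Proof.
move=> g0 gM; pose E := [set \sum_(x <- s) g x | s in [set s | uniq s]].
have E0 : E !=set0 by exists 0; exists [::]; rewrite ?big_nil.
have Eb : has_ubound E by exists M => _ [s /= us <-]; exact: gM.
have gS : fin_bounded g (sup E).
  by move=> s us; apply: ub_le_sup => //; exists s.
exists (sup E); split => //; last first.
  by move=> M' hM'; apply: ge_sup => // _ [s /= us <-]; exact: hM'.
apply/cvgrPdist_le => e /gt0_complex[r r0 ->].
have [_ [s /= us <-] hs] := sup_adherent r0 (conj E0 Eb).
exists [fset x in s]%fset => // B /= sB.
rewrite partial_sumE -rmorph_sum /= -rmorphB /= normc_def /= expr0n addr0.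
rewrite sqrtr_sqr lecR ger0_norm ?subr_ge0 ?gS //.
have : \sum_(x <- s) g x <= \sum_(x <- B) g x.
  rewrite (sum_fsetD _ sB) ler_wpDr ?sumr_ge0 //.
  rewrite le_eqVlt; apply/orP; left; apply/eqP; apply: perm_big.
  by apply: uniq_perm => // x; rewrite !inE.
by lra.
Qed.

Lemma cvg_partial_sum z M :
  fin_bounded (fun x => Normc.normc (z x)) M -> cvg (partial_sum z @ totally).
Proof.
move=> zM; apply: complex_complete; apply/cauchyP => e /gt0_complex[r r0 ->].
have n0 x : 0 <= Normc.normc (z x) by case: (z x) => a b; exact: sqrtr_ge0.
have [S [cS bS _]] := fin_bounded_sum n0 zM.
have r2 : 0 < ((r / 2)%:C : R[i]) by rewrite ltcR divr_gt0.
have [A _ hA] := cvgr_dist_le _ _ cS _ r2.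
exists (partial_sum z A); exists A => // B /= AB.
rewrite -ball_normE /ball_ /= !partial_sumE (sum_fsetD _ AB).
rewrite opprD addrA subrr add0r normrN (le_lt_trans (ler_norm_sum _ _ _)) //.
have := hA A (fsubset_refl _).
rewrite /= partial_sumE -rmorph_sum /= -rmorphB /= normc_def /= expr0n addr0.
rewrite sqrtr_sqr lecR ler_norml => /andP[_ hSA].
have := bS B (fset_uniq _); rewrite (sum_fsetD _ AB) => hSB.
have -> : \sum_(x <- (B `\` A)%fset) `|z x| =
    (\sum_(x <- (B `\` A)%fset) Normc.normc (z x))%:C by rewrite rmorph_sum.
rewrite ltcR; lra.
Qed.

End UnorderedSums.

(* The inner product is antilinear in its first argument, so mathcomp's        *)
(* {dot _ for _}, which is antilinear in the second one, does not apply.       *)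
HB.mixin Record CompleteNormedModule_isHilbert (R : realType) H
    & CompleteNormedModule R[i] H := {
  hdot : H -> H -> R[i] ;
  hdotP : forall (u : H) (a : R[i]) (v w : H),
    hdot u (a *: v + w) = a * hdot u v + hdot u w ;
  hdotC : forall u v : H, hdot v u = (hdot u v)^* ;
  hdot_norm : forall u : H, hdot u u = `|u| ^+ 2
}.

#[short(type="hilbertType")]
HB.structure Definition Hilbert (R : realType) :=
  {H of CompleteNormedModule_isHilbert R H & CompleteNormedModule R[i] H}.

Section l2_space.
Variables (R : realType) (X : choiceType).
#[local] Existing Instance totally_filter.

Definition square_summable (phi : X -> R[i]^o) : Prop :=
  (\esum_(x in [set: X]) (Normc.normc (phi x) ^+ 2)%:E < +oo)%E.

Definition square_summable_pred : {pred X -> R[i]^o} :=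
  fun phi => `[< square_summable phi >].

Record l2 : Type := MkL2 {
  l2_fun :> X -> R[i]^o ;
  l2_funP : l2_fun \in square_summable_pred }.

HB.instance Definition _ := [isSub for l2_fun].
HB.instance Definition _ := [Choice of l2 by <:].

Lemma square_summableP (phi : X -> R[i]^o) : square_summable phi <->
  exists M, fin_bounded (fun x => Normc.normc (phi x) ^+ 2) M.
Proof. by apply: esum_fin_bounded => x; exact: sqr_ge0. Qed.

Lemma square_summable_predP (phi : X -> R[i]^o) :
  phi \in square_summable_pred <->
  exists M, fin_bounded (fun x => Normc.normc (phi x) ^+ 2) M.
Proof. by rewrite -square_summableP; split=> /asboolP. Qed.

Fact square_summable_submod : submod_closed square_summable_pred.
Proof.
split=> [|a phi psi].
  apply/square_summable_predP; exists 0 => s _.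
  by rewrite big1 // => x _; rewrite Normc.normc0 expr0n.
move=> /square_summable_predP[M hM] /square_summable_predP[N hN].
apply/square_summable_predP.
exists (2 * (Normc.normc a ^+ 2 * M) + 2 * N) => s us.
have hle : \sum_(x <- s) Normc.normc ((a *: phi + psi) x) ^+ 2 <=
  \sum_(x <- s) (2 * (Normc.normc a ^+ 2 * Normc.normc (phi x) ^+ 2) +
                 2 * Normc.normc (psi x) ^+ 2).
  apply: ler_sum => x _.
  have n0 (z : R[i]) : 0 <= Normc.normc z by case: z => ? ?; exact: sqrtr_ge0.
  rewrite -[(a *: phi + psi) x]/(a * phi x + psi x) -exprMn.
  have := le_normcD (a * phi x) (psi x); rewrite Normc.normcM.
  have := n0 (a * phi x + psi x).
  set w := Normc.normc (_ + _); set u := Normc.normc a * _.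
  set v := Normc.normc (psi x) => w0 wuv.
  have : w ^+ 2 <= (u + v) ^+ 2 by rewrite ler_sqr ?nnegrE // (le_trans w0).
  have := sqr_ge0 (u - v); rewrite !expr2; lra.
apply: (le_trans hle); rewrite big_split /= -!mulr_sumr lerD //.
  by rewrite ler_pM2l // ler_wpM2l ?sqr_ge0 ?hM.
by rewrite ler_pM2l ?hN.
Qed.

HB.instance Definition _ := GRing.isSubmodClosed.Build R[i] (X -> R[i]^o)
  square_summable_pred square_summable_submod.
HB.instance Definition _ := [SubChoice_isSubLmodule of l2 by <:].

(* summability.sum is the unordered sum: the limit of the sums over finite     *)
(* subsets of X, along inclusion. The terms are absolutely summable, so the    *)
(* limit exists (l2_dot_cvg).                                                  *)
Definition l2_dot (phi psi : l2) : R[i] :=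
  summability.sum (fun x => (phi x)^* * psi x : R[i]^o).

Lemma l2_sqr_bounded (phi : l2) :
  exists M, fin_bounded (fun x => Normc.normc (phi x) ^+ 2) M.
Proof. by apply/square_summable_predP; exact: l2_funP. Qed.

Lemma l2_dot_cvg (phi psi : l2) :
  partial_sum (fun x => (phi x)^* * psi x : R[i]^o) @ totally
    --> (l2_dot phi psi : R[i]^o).
Proof.
have [M hM] := l2_sqr_bounded phi; have [N hN] := l2_sqr_bounded psi.
apply: (@cvg_partial_sum _ _ _ (M + N)) => s us.
apply: le_trans (lerD (hM s us) (hN s us)).
rewrite -big_split /=; apply: ler_sum => x _; rewrite Normc.normcM.
have -> : Normc.normc (phi x)^* = Normc.normc (phi x).
  by apply: complexI; exact: (norm_conjC (phi x)).
set u := Normc.normc _; set v := Normc.normc _.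
have := sqr_ge0 (u - v); have := sqr_ge0 u; have := sqr_ge0 v.
by rewrite !expr2; nra.
Qed.

Lemma l2_dot_lim (phi psi : l2) (l : R[i]) :
  partial_sum (fun x => (phi x)^* * psi x : R[i]^o) @ totally --> (l : R[i]^o) ->
  l2_dot phi psi = l.
Proof. by move=> h; rewrite /l2_dot /summability.sum; apply: (cvg_lim _ h); exact: norm_hausdorff. Qed.

Lemma l2_dotP (u : l2) (a : R[i]) (v w : l2) :
  l2_dot u (a *: v + w) = a * l2_dot u v + l2_dot u w.
Proof.
apply: l2_dot_lim.
have h := cvgD (cvgZl_tmp (k := a) (@l2_dot_cvg u v)) (@l2_dot_cvg u w).
suff -> : partial_sum (fun x => (u x)^* * (a *: v + w) x : R[i]^o) =
  a \*: partial_sum (fun x => (u x)^* * v x : R[i]^o) +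
  partial_sum (fun x => (u x)^* * w x : R[i]^o) by exact: h.
apply/funext => A; rewrite -[RHS]/(a *: _ + _) !partial_sumE scaler_sumr.
rewrite -big_split /=.
apply: eq_bigr => x _; rewrite -[LHS]/((u x)^* * (a * v x + w x)).
by rewrite -[a *: _]/(a * _) mulrDr mulrCA.
Qed.

Lemma l2_dotC (u v : l2) : l2_dot v u = (l2_dot u v)^*.
Proof.
apply: l2_dot_lim; apply/cvgrPdist_le => e e0.
apply: filterS (cvgr_dist_le _ _ (@l2_dot_cvg u v) _ e0) => A; rewrite !partial_sumE => h.
rewrite -norm_conjC rmorphB /= conjCK rmorph_sum /=; apply: le_trans h.
rewrite le_eqVlt; apply/orP; left; apply/eqP; congr (`| _ - _|).
by apply: eq_bigr => x _; rewrite rmorphM /= conjCK mulrC.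
Qed.

Lemma l2_dotE (u : l2) : exists S : R,
  [/\ l2_dot u u = S%:C,
      fin_bounded (fun x => Normc.normc (u x) ^+ 2) S &
      forall M, fin_bounded (fun x => Normc.normc (u x) ^+ 2) M -> S <= M].
Proof.
have [M hM] := l2_sqr_bounded u.
have [|S [cS bS lS]] := fin_bounded_sum _ hM; first by move=> x; exact: sqr_ge0.
exists S; split=> //; apply: l2_dot_lim.
suff -> : partial_sum (fun x => (u x)^* * u x : R[i]^o) =
  partial_sum (fun x => (Normc.normc (u x) ^+ 2)%:C : R[i]^o) by [].
apply/funext => A; rewrite !partial_sumE; apply: eq_bigr => x _.
by rewrite rmorphXn /= -[(Normc.normc _)%:C]/(`|u x|) normCK mulrC.
Qed.

Lemma l2_dot_ge0 (u : l2) : 0 <= l2_dot u u.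
Proof.
have [S [-> bS _]] := l2_dotE u.
by rewrite ler0c; have := bS [::] isT; rewrite big_nil.
Qed.

Definition l2_norm (u : l2) : R[i] := sqrtC (l2_dot u u).

Lemma l2_eval_le (u : l2) x : `|u x : R[i]| <= l2_norm u.
Proof.
rewrite -ler_sqr ?nnegrE ?sqrtC_ge0 ?l2_dot_ge0 // sqrtCK.
have [S [-> bS _]] := l2_dotE u; have := bS [:: x] isT.
by rewrite big_seq1 -lecR rmorphXn.
Qed.

Lemma l2_norm0_eq0 (u : l2) : l2_norm u = 0 -> u = 0.
Proof.
move=> u0; apply/val_inj/funext => x /=.
have := l2_eval_le u x; rewrite u0 normr_le0 => /eqP; exact.
Qed.

HB.instance Definition _ := Lmodule_isNormed.Build R[i] l2
  (@ip_triangle _ _ l2_dot l2_dotP l2_dotC l2_dot_ge0)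
  (@ip_normZ _ _ l2_dot l2_dotP l2_dotC l2_dot_ge0) l2_norm0_eq0.

Lemma l2_normE (u : l2) : `|u| = l2_norm u. Proof. by []. Qed.

Lemma l2_dot_norm (u : l2) : l2_dot u u = `|u| ^+ 2.
Proof. by rewrite l2_normE sqrtCK. Qed.

End l2_space.

Section l2_hilbert.
Variables (R : realType) (X : choiceType).
Local Notation l2 := (l2 R X).

Lemma normc_ge0 (z : R[i]) : 0 <= Normc.normc z.
Proof. by case: z => a b; exact: sqrtr_ge0. Qed.

Lemma l2_norm_le (u : l2) (r : R) : 0 <= r ->
  `|u| <= r%:C <-> fin_bounded (fun x => Normc.normc (u x) ^+ 2) (r ^+ 2).
Proof.
move=> r0; have [S [uS bS lS]] := l2_dotE u.
have -> : (`|u| <= r%:C) = (S <= r ^+ 2).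
  by rewrite -ler_sqr ?nnegrE ?ler0c // -l2_dot_norm uS -rmorphXn lecR.
split=> [Sr s us|]; last exact: lS.
exact: le_trans (bS s us) Sr.
Qed.

Lemma l2_complete (F : set_system l2) : ProperFilter F -> cauchy F -> cvg F.
Proof.
move=> FF /cauchyP Fc.
have evc x : cvg ((fun u : l2 => u x) @ F).
  apply: complex_complete; apply/cauchyP => e e0.
  have [u Fu] := Fc e e0; exists (u x).
  suff : F ((fun u : l2 => u x) @^-1` ball (u x) e) by [].
  apply: filterS Fu => v; rewrite /= -!ball_normE /ball_ /= => uv.
  exact: le_lt_trans (l2_eval_le (u - v) x) uv.
pose phi x : R[i]^o := lim ((fun u : l2 => u x) @ F).
have key (v : l2) (r : R) : 0 < r -> F (ball v r%:C) ->
    fin_bounded (fun x => Normc.normc (v x - phi x) ^+ 2) (r ^+ 2).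
  move=> r0 Fv s us.
  have lim1 x : (fun u : l2 => Normc.normc (v x - u x)) @ F -->
      Normc.normc (v x - phi x).
    apply/cvgrPdist_le => e e0.
    have e0' : 0 < (e%:C : R[i]) by rewrite ltcR.
    apply: filterS (cvgr_dist_le _ _ (evc x) _ e0') => u /= hu.
    rewrite -lecR; apply: le_trans hu.
    have := lerB_dist (v x - phi x : R[i]) (v x - u x).
    have := lerB_dist (v x - u x : R[i]) (v x - phi x).
    have -> : v x - u x - (v x - phi x) = phi x - u x :> R[i] by ring.
    have -> : v x - phi x - (v x - u x) = - (phi x - u x) :> R[i] by ring.
    rewrite normrN -[X in _ <= X]/((Normc.normc (phi x - u x))%:C).
    rewrite -[(`|v x - u x : R[i]|)]/((Normc.normc (v x - u x))%:C).
    rewrite -[(`|v x - phi x : R[i]|)]/((Normc.normc (v x - phi x))%:C).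
    rewrite -!rmorphB !lecR => h1 h2.
    by rewrite ler_norml h2 andbT; lra.
  have lims : (fun u : l2 => \sum_(x <- s) Normc.normc (v x - u x) ^+ 2) @ F -->
      \sum_(x <- s) Normc.normc (v x - phi x) ^+ 2.
    elim: s {us} => [|x s IH].
      rewrite big_nil; under eq_fun do rewrite big_nil; exact: cvg_cst.
    rewrite big_cons; under eq_fun do rewrite big_cons.
    by apply: cvgD => //; rewrite expr2; under eq_fun do rewrite expr2;
      apply: cvgM.
  rewrite -(cvg_lim _ lims); last exact: norm_hausdorff.
  apply: limr_le; first by apply/cvg_ex; eexists; exact: lims.
  apply: filterS Fv => u; rewrite -ball_normE /ball_ /= => /ltW.
  by move/(l2_norm_le _ (ltW r0)); apply.
have [v1 Fv1] := Fc 1 ltr01.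
have phiP : phi \in @square_summable_pred R X.
  have -> : phi = (- 1) *: (l2_fun v1 - phi) + l2_fun v1.
    by rewrite scaleN1r opprB subrK.
  apply: (square_summable_submod R X).2; last exact: l2_funP.
  apply/square_summable_predP; exists (1 ^+ 2); apply: key => //.
apply/cvg_ex; exists (MkL2 phiP).
apply/(@cvgrPdist_le _ _ _ F _ id) => e /gt0_complex[r r0 ->].
have r2 : 0 < r / 2 by rewrite divr_gt0.
have r2' : 0 < ((r / 2)%:C : R[i]) by rewrite ltcR.
have [v Fv] := Fc _ r2'.
have hv : `|v - MkL2 phiP| <= (r / 2)%:C by apply/l2_norm_le; [exact: ltW|exact: key].
apply: filterS Fv => u; rewrite -ball_normE /ball_ /= => /ltW hu.
have -> : MkL2 phiP - u = (v - u) - (v - MkL2 phiP).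
  by rewrite opprB [RHS]addrC addrA subrK.
apply: (le_trans (ler_normB _ _)).
by rewrite [X in _ <= X%:C]splitr rmorphD /= lerD.
Qed.

HB.instance Definition _ := Uniform_isComplete.Build l2 l2_complete.

HB.instance Definition _ := CompleteNormedModule_isHilbert.Build R l2
  (@l2_dotP R X) (@l2_dotC R X) (@l2_dot_norm R X).

End l2_hilbert.

(* Riesz representation, by minimising |u|^2 - 2 Re (L u); it is needed for    *)
(* every morphism of Hilbert spaces to have an adjoint.                        *)
Section Riesz.
Variables (R : realType) (H : hilbertType R).

Lemma hdot_ge0 (u : H) : 0 <= hdot u u.
Proof. by rewrite hdot_norm exprn_ge0. Qed.

Lemma hdot_CS (u v : H) : `|hdot u v| <= `|u| * `|v|.
Proof.
rewrite -ler_sqr ?nnegrE ?mulr_ge0 // exprMn -!hdot_norm.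
exact: (ip_CS hdotP hdotC hdot_ge0).
Qed.

Lemma hdot_inj (u v : H) : (forall w, hdot u w = hdot v w) -> u = v.
Proof.
move=> uv; apply/eqP; rewrite -subr_eq0 -normr_eq0 -sqrf_eq0 -hdot_norm.
by rewrite (ipDl hdotP hdotC) (ipNl hdotP hdotC) uv subrr.
Qed.

Variables (L : H -> R[i]) (c : R[i]).
Hypothesis LP : forall a u v, L (a *: u + v) = a * L u + L v.
Hypothesis Lc : forall u, `|L u| <= c * `|u|.
Hypothesis c0 : 0 < c.

Let Jc (u : H) : R[i] := hdot u u - (L u + (L u)^*).
Let J (u : H) : R := complex.Re (Jc u).

Let JcE u : Jc u = (J u)%:C.
Proof.
rewrite RRe_real // CrealE /Jc rmorphB rmorphD /= conjCK -hdotC.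
by rewrite [_^* + _]addrC.
Qed.

Let L0 : L 0 = 0.
Proof.
have := LP 1 0 0; rewrite scaler0 addr0 mul1r => h.
by apply: (addrI (L 0)); rewrite addr0.
Qed.

Let Jc_ge u : - c ^+ 2 <= Jc u.
Proof.
have h : L u + (L u)^* <= 2 * (c * `|u|).
  have -> : L u + (L u)^* = 2 * 'Re (L u).
    by rewrite ReE mulrC divfK ?pnatr_eq0.
  rewrite ler_pM2l ?ltr0n //; apply: le_trans (Lc u).
  by have [] := leif_Re_Creal (L u).
rewrite -subr_ge0 opprK /Jc hdot_norm.
have n0 : `|u| \is Num.real by exact: normr_real.
have cr : c \is Num.real by exact: gtr0_real.
apply: (le_trans (y := (`|u| - c) ^+ 2)).
  by rewrite real_exprn_even_ge0 // rpredB.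
rewrite -subr_ge0.
have -> : `|u| ^+ 2 - (L u + (L u)^*) + c ^+ 2 - (`|u| - c) ^+ 2 =
  2 * (c * `|u|) - (L u + (L u)^*) by ring.
by rewrite subr_ge0.
Qed.

Let JcD u v t : Jc (u + t *: v) =
  Jc u + (t * (hdot u v - L v) + (t * (hdot u v - L v))^*) +
  t * t^* * hdot v v.
Proof.
rewrite /Jc (ip_sqD hdotP hdotC) addrC [u + _]addrC LP.
rewrite !(rmorphD, rmorphM, rmorphB) /=; ring.
Qed.

Let near_min (r : R) : set H :=
  [set u | forall v, `|hdot u v - L v| <= r%:C * `|v|].

Let near_min_ne r : 0 < r -> near_min r !=set0.
Proof.
move=> r0; pose E := range J.
have E0 : E !=set0 by exists (J 0); exists 0.
have [c' c'0 cE] := gt0_complex c0.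
have Elb : lbound E (- c' ^+ 2).
  by move=> _ [u _ <-]; rewrite -lecR rmorphN rmorphXn /= -cE -JcE Jc_ge.
have r20 : 0 < r ^+ 2 by rewrite exprn_gt0.
have [_ [u _ <-] hu] := inf_adherent r20 (conj E0 (ex_intro _ _ Elb)).
exists u => v.
have Jle w : J u - r ^+ 2 <= J w.
  have : inf E <= J w by apply: ge_inf; [exists (- c' ^+ 2)|exists w].
  by move: hu; lra.
have [->|v0] := eqVneq v 0.
  by rewrite L0 (ip0 hdotP) subr0 !normr0 mulr0.
set d := hdot u v - L v.
have [q qE] : exists q : R[i], q = `|v| ^+ 2 by eexists.
have vp : 0 < q by rewrite qE exprn_gt0 // normr_gt0.
have vr : q^* = q by rewrite conj_Creal // gtr0_real.
have rC : 0 <= (r%:C : R[i]) by rewrite ler0c ltW.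
rewrite -ler_sqr ?nnegrE ?mulr_ge0 // exprMn -qE.
have := Jle (u + (- (d^* / q)) *: v).
rewrite -lecR rmorphB rmorphXn /= -!JcE JcD -/d hdot_norm -qE lerBlDr -addrA -addrA.
rewrite lerDl => h; rewrite -subr_ge0.
have q0 : q != 0 by rewrite gt_eqF.
rewrite -(pmulr_rge0 _ vp) in h; move: h; congr (is_true (0 <= _)).
rewrite !(rmorphN, rmorphM, fmorphV) /= conjCK vr normCK.
by field.
Qed.

Lemma riesz : exists chi : H, forall v, hdot chi v = L v.
Proof.
pose F : set_system H := filter_from [set r : R | 0 < r] near_min.
have FF : ProperFilter F.
  apply: filter_from_proper; last by move=> r; exact: near_min_ne.
  apply: filter_from_filter; first by exists 1; exact: ltr01.
  move=> r s /= r0 s0; exists (Num.min r s); first by rewrite /= lt_min r0.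
  by move=> u hu; split=> v; apply: le_trans (hu v) _;
    rewrite ler_wpM2r // lecR ge_min lexx ?orbT.
have Fc : cauchy F.
  apply/cauchyP => e /gt0_complex[r r0 ->].
  have r3 : 0 < r / 3 by rewrite divr_gt0.
  have [u hu] := near_min_ne r3; exists u; exists (r / 3) => // v hv.
  rewrite -ball_normE /ball_ /=.
  have [->|uv0] := eqVneq u v; first by rewrite subrr normr0 ltcR.
  have p : 0 < `|u - v| by rewrite normr_gt0 subr_eq0.
  have h : `|u - v| ^+ 2 <= (r / 3 + r / 3)%:C * `|u - v|.
    have e2 : `|u - v| ^+ 2 =
        (hdot u (u - v) - L (u - v)) - (hdot v (u - v) - L (u - v)).
      by rewrite -hdot_norm (ipDl hdotP hdotC) (ipNl hdotP hdotC); ring.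
    rewrite -[X in X <= _]ger0_norm ?exprn_ge0 // e2.
    apply: (le_trans (ler_normB _ _)).
    by rewrite rmorphD /= mulrDl lerD // ?hu ?hv.
  rewrite expr2 ler_pM2r // in h; apply: le_lt_trans h _.
  by rewrite ltcR; lra.
have [chi hchi] := (cvg_ex F).1 (cauchy_cvg F Fc).
exists chi => v; apply/eqP; rewrite -subr_eq0 -normr_le0.
apply/ler_addgt0Pr => e /gt0_complex[r r0 ->]; rewrite add0r.
have [n n0 nE] : exists2 n : R, 0 <= n & `|v| = n%:C.
  exists (complex.Re `|v|); last by rewrite RRe_real ?normr_real.
  by rewrite -ler0c RRe_real ?normr_real.
pose s := r / (2 * (n + 1)).
have s0 : 0 < s by rewrite divr_gt0 // mulr_gt0 // ltr_wpDl.
have s0' : 0 < (s%:C : R[i]) by rewrite ltcR.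
have Fs : F (near_min s) by exists s.
have Fb := (@cvgr_dist_le _ _ _ F _ id chi hchi _ s0').
have [u [us ub]] := filter_ex (filterI Fs (Fb _)).
have -> : hdot chi v - L v = hdot (chi - u) v + (hdot u v - L v).
  by rewrite (ipDl hdotP hdotC) (ipNl hdotP hdotC); ring.
apply: (le_trans (ler_normD _ _)).
apply: (le_trans (lerD (hdot_CS _ _) (us v))).
apply: (le_trans (y := s%:C * `|v| + s%:C * `|v|)).
  by rewrite lerD2r ler_wpM2r.
rewrite nE -!rmorphM -rmorphD lecR /s /=.
have -> : r / (2 * (n + 1)) * n + r / (2 * (n + 1)) * n = r * (n / (n + 1)).
  by field; lra.
rewrite ger_pMr // ler_pdivrMr ?mul1r; lra.
Qed.

End Riesz.

Record hilb_hom (R : realType) (H K : hilbertType R) := HilbHom {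
  hom_fun :> H -> K ;
  hom_linear : linear hom_fun ;
  hom_continuous : continuous hom_fun }.

Section Adjoint.
Variables (R : realType).

Lemma linear_bounded (H K : hilbertType R) (f : hilb_hom H K) :
  exists2 c : R[i], 0 < c & forall u, `|f u| <= c * `|u|.
Proof.
pose lf : {linear H -> K} := HB.pack (hom_fun f)
  (GRing.isLinear.Build _ _ _ _ _ (hom_linear f)).
have /linear_bounded_continuous/linear_boundedP := @hom_continuous _ _ _ f : continuous lf.
by move=> /pinfty_ex_gt0[c c0 hc]; exists c.
Qed.

Lemma bounded_linear_cts (H K : hilbertType R) (f : H -> K) (c : R[i]) :
  0 < c -> linear f -> (forall u, `|f u| <= c * `|u|) -> continuous f.
Proof.
move=> c0 fl fc; pose lf : {linear H -> K} := HB.pack f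
  (GRing.isLinear.Build _ _ _ _ _ fl).
have h : \forall r \near +oo, forall x, `|lf x| <= r * `|x|.
  near=> r => x; apply: (le_trans (fc x)); rewrite ler_wpM2r //; near: r.
  by apply: nbhs_pinfty_ge; exact: gtr0_real.
by have /linear_boundedP/linear_bounded_continuous := h.
Unshelve. all: by end_near. Qed.

Definition is_adjoint (H K : hilbertType R) (f : H -> K) (g : K -> H) :=
  forall phi psi, hdot (f phi) psi = hdot phi (g psi).

Theorem adjoint_exists (H K : hilbertType R) (f : hilb_hom H K) :
  exists g : hilb_hom K H, is_adjoint f g.
Proof.
have [c c0 fc] := linear_bounded f.
have /choice[g gP] (psi : K) : exists chi : H, forall v, hdot chi v = hdot psi (f v).
  apply: (@riesz _ _ _ (c * (`|psi| + 1))) => [a u v|u|].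
  - by rewrite hom_linear hdotP.
  - apply: (le_trans (hdot_CS _ _)); rewrite mulrC.
    apply: (le_trans (ler_wpM2r _ (fc u))) => //.
    rewrite -!mulrA ler_pM2l // mulrC ler_wpM2r //.
    by rewrite lerDl ler01.
  - by rewrite mulr_gt0 // ltr_wpDl.
have gl : linear g.
  move=> a u v; apply: hdot_inj => w.
  rewrite gP (ipDl hdotP hdotC) (ipZl hdotP hdotC).
  by rewrite (ipDl hdotP hdotC) (ipZl hdotP hdotC) !gP.
have gc : continuous g.
  apply: (@bounded_linear_cts _ _ _ c) => // psi.
  have [->|g0] := eqVneq (g psi) 0; first by rewrite normr0 mulr_ge0 // ltW.
  have p : 0 < `|g psi| by rewrite normr_gt0.
  rewrite -(ler_pM2r p) -expr2 -hdot_norm gP.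
  rewrite -[X in X <= _]ger0_norm; last by rewrite -gP hdot_ge0.
  apply: (le_trans (hdot_CS _ _)).
  by rewrite mulrAC [X in _ <= X]mulrC ler_wpM2l.
exists (HilbHom gl gc) => phi psi.
by rewrite hdotC -gP -hdotC.
Qed.

(* Adjoints are unique by hdot_inj, so the choice made by cid is immaterial.   *)
Definition hilb_dagger (H K : hilbertType R) (f : hilb_hom H K) : hilb_hom K H :=
  projT1 (cid (adjoint_exists f)).

End Adjoint.

(* A partial injection is given by its graph, so that the dagger is literally  *)
(* the converse relation.                                                      *)
Record pinj (X Y : Type) := PInj {
  pinj_rel :> X -> Y -> Prop ;
  pinj_functional : forall x y y', pinj_rel x y -> pinj_rel x y' -> y = y' ;
  pinj_injective : forall x x' y, pinj_rel x y -> pinj_rel x' y -> x = x' }.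

Definition pinj_dagger (X Y : Type) (f : pinj X Y) : pinj Y X :=
  @PInj Y X (fun y x => f x y)
    (fun y x x' => @pinj_injective X Y f x x' y)
    (fun y y' x => @pinj_functional X Y f x y y').

Section l2_functor.
Variables (R : realType) (X Y : choiceType) (f : pinj X Y).

(* Value phi x at y for the unique x with f x y, and 0 if there is none.       *)
Definition l2_map_fun (phi : X -> R[i]^o) (y : Y) : R[i]^o :=
  if pselect (exists x, f x y) is left e then phi (projT1 (cid e)) else 0.

Lemma l2_map_funP (phi : X -> R[i]^o) x y : f x y -> l2_map_fun phi y = phi x.
Proof.
move=> fxy; rewrite /l2_map_fun; case: pselect => [e|[]]; last by exists x.
by congr phi; apply: (pinj_injective (projT2 (cid e)) fxy).
Qed.

Lemma l2_map_fun0 (phi : X -> R[i]^o) y :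
  ~ (exists x, f x y) -> l2_map_fun phi y = 0.
Proof. by move=> nf; rewrite /l2_map_fun; case: pselect. Qed.

Lemma l2_map_fun_bounded (phi : X -> R[i]^o) M :
  fin_bounded (fun x => Normc.normc (phi x) ^+ 2) M ->
  fin_bounded (fun y => Normc.normc (l2_map_fun phi y) ^+ 2) M.
Proof.
move=> hM s us.
suff [t [ut ts ->]] : exists t : seq X,
    [/\ uniq t, forall x, x \in t -> exists2 y, y \in s & f x y &
     \sum_(y <- s) Normc.normc (l2_map_fun phi y) ^+ 2 =
     \sum_(x <- t) Normc.normc (phi x) ^+ 2] by exact: hM.
elim: s us => [_|y s IH /= /andP[ys us]]; first by exists [::]; rewrite !big_nil.
have [t [ut ts e]] := IH us; rewrite big_cons e.
have [[x fxy]|nf] := pselect (exists x, f x y).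
  exists (x :: t); split=> /=; last by rewrite big_cons (l2_map_funP _ fxy).
    rewrite ut andbT; apply/negP => /ts[y' y's fxy'].
    by move: ys; rewrite (pinj_functional fxy fxy') y's.
  move=> x'; rewrite inE => /orP[/eqP ->|/ts[y' y's fxy']].
    by exists y => //; rewrite inE eqxx.
  by exists y' => //; rewrite inE y's orbT.
exists t; split=> //; last by rewrite (l2_map_fun0 _ nf) Normc.normc0 expr0n add0r.
by move=> x' /ts[y' y's fxy']; exists y' => //; rewrite inE y's orbT.
Qed.

Fact l2_map_subproof (phi : l2 R X) : l2_map_fun phi \in @square_summable_pred R Y.
Proof.
have [M hM] := l2_sqr_bounded phi; apply/square_summable_predP; exists M.
exact: l2_map_fun_bounded.
Qed.

Definition l2_map_op (phi : l2 R X) : l2 R Y := MkL2 (l2_map_subproof phi).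

Fact l2_map_linear : linear l2_map_op.
Proof.
move=> a u v; apply/val_inj/funext => y /=.
rewrite -[RHS]/(a * l2_map_fun u y + l2_map_fun v y) /l2_map_fun.
case: pselect => // _; by rewrite mulr0 addr0.
Qed.

Fact l2_map_continuous : continuous l2_map_op.
Proof.
apply: (@bounded_linear_cts _ _ _ _ 1) => //; first exact: l2_map_linear.
move=> u; rewrite mul1r.
have [r r0 uE] : exists2 r : R, 0 <= r & `|u| = r%:C.
  exists (complex.Re `|u|); last by rewrite RRe_real ?normr_real.
  by rewrite -ler0c RRe_real ?normr_real.
rewrite uE; apply/l2_norm_le => //; apply: l2_map_fun_bounded.
by apply/l2_norm_le => //; rewrite -uE.
Qed.

Definition l2_map : hilb_hom (l2 R X) (l2 R Y) :=
  HilbHom l2_map_linear l2_map_continuous.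

End l2_functor.

(* Main.v *)
Require Import Defs.
From mathcomp Require Import all_boot all_order all_algebra.
From mathcomp Require Import complex.
From mathcomp Require Import all_classical all_reals all_analysis.
From mathcomp Require Import finmap.
From mathcomp.analysis.showcase Require Import summability.

Import Order.TTheory GRing.Theory Num.Theory.
Local Open Scope classical_set_scope.
Local Open Scope ring_scope.

(** Both inner products are unordered sums of the same family, indexed through
the two ends of the graph of [f]: if [f x y] then
[(l2 f phi)(y)^* * psi y = phi(x)^* * psi y = phi(x)^* * (l2 f^dag psi)(x)], while
the left-hand term vanishes at every [y] outside the range of [f] and the
right-hand term at every [x] outside its domain.

For finite sets the reindexing is a double counting ([sum_graph_fiber],
[sum_pinj]): the sums over [A] and [B] both equal the sum over the edges of the
graph of [f] between [A] and [B], as soon as no edge leaves one set without ending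
in the other. For the limits, any finite set of points of [X] containing the
preimage of a given finite [B0] has the same sum as some finite set of points of
[Y] containing [B0], so convergence over [Y] gives convergence over [X] to the
same value ([cvg_sum_pinj]).

The equality of morphisms then follows since adjoints are unique. *)

Lemma pinj_fset_image (X Y : choiceType) (f : pinj X Y) (A : {fset X}) :
  exists B : {fset Y}, forall y, y \in B <-> exists2 x, x \in A & f x y.
Proof.
suff [s sP] : exists s : seq Y,
    forall y, y \in s <-> exists2 x, x \in enum_fset A & f x y.
  by exists [fset y in s]%fset => y; rewrite inE; exact: sP.
elim: (enum_fset A) => [|x t [s sP]].
  by exists [::] => y; split=> // -[].
have [[y fxy]|nf] := pselect (exists y, f x y).
  exists (y :: s) => y'; rewrite inE; split=> [/orP[/eqP ->|/sP[x' x't fx']]|].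
  - by exists x; rewrite ?mem_head.
  - by exists x'; rewrite // inE x't orbT.
  - move=> [x']; rewrite inE => /orP[/eqP -> fxy'|x't fx'].
      by rewrite (pinj_functional fxy fxy') eqxx.
    by apply/orP; right; apply/sP; exists x'.
exists s => y; split=> [/sP[x' x't fx']|[x']].
  by exists x'; rewrite // inE x't orbT.
rewrite inE => /orP[/eqP -> fxy|x't fx']; first by case: nf; exists y.
by apply/sP; exists x'.
Qed.

(** The edges at [x] number one or none, and [c] is zero in the latter case. *)
Lemma sum_graph_fiber (V : zmodType) (X Y : choiceType) (f : pinj X Y)
    (B : {fset Y}) (x : X) (c : V) :
  (forall y, f x y -> y \in B) -> (~ (exists y, f x y) -> c = 0) ->
  \sum_(y <- B) (if `[< f x y >] then c else 0) = c.
Proof.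
move=> fB c0; have [[y fxy]|nf] := pselect (exists y, f x y).
  rewrite (big_fsetD1 y) ?fB //= asboolT // big_seq big1 ?addr0 // => y'.
  rewrite !inE => /andP[y'y _]; rewrite asboolF // => fxy'.
  by move: y'y; rewrite (pinj_functional fxy fxy') eqxx.
by rewrite big1 c0 // => y _; case: ifP.
Qed.

Lemma sum_pinj (V : zmodType) (X Y : choiceType) (f : pinj X Y)
    (u : X -> V) (v : Y -> V) (A : {fset X}) (B : {fset Y}) :
  (forall x y, f x y -> u x = v y) ->
  (forall x, ~ (exists y, f x y) -> u x = 0) ->
  (forall y, ~ (exists x, f x y) -> v y = 0) ->
  (forall x y, f x y -> (x \in A) = (y \in B)) ->
  \sum_(x <- A) u x = \sum_(y <- B) v y.
Proof.
move=> uv u0 v0 AB.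
transitivity (\sum_(x <- A) \sum_(y <- B) (if `[< f x y >] then u x else 0)).
  rewrite big_seq [RHS]big_seq; apply: eq_bigr => x xA.
  rewrite sum_graph_fiber // => [y fxy|]; last exact: u0.
  by rewrite -(AB x).
rewrite exchange_big /= big_seq [RHS]big_seq; apply: eq_bigr => y yB.
rewrite -[RHS](@sum_graph_fiber _ _ _ (pinj_dagger f) A y) => [|x /AB -> //|];
  last exact: v0.
by apply: eq_bigr => x _ /=; case: asboolP => // /uv.
Qed.

(** If a finite [A] contains the preimage of a finite [B0], then every edge of [f]
that starts in [A] ends in the union of [B0] and the image of [A], and conversely;
so [sum_pinj] applies to this pair of sets. *)
Lemma cvg_sum_pinj (R : realType) (X Y : choiceType) (f : pinj X Y)
    (u : X -> R[i]^o) (v : Y -> R[i]^o) (l : R[i]^o) :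
  (forall x y, f x y -> u x = v y) ->
  (forall x, ~ (exists y, f x y) -> u x = 0) ->
  (forall y, ~ (exists x, f x y) -> v y = 0) ->
  partial_sum v @ totally --> l -> partial_sum u @ totally --> l.
Proof.
move=> uv u0 v0 vl W /vl[B0 _ hB0].
have [A0 A0P] := pinj_fset_image _ _ (pinj_dagger f) B0.
exists A0 => // A /= A0A; have [B BP] := pinj_fset_image _ _ f A.
suff uE : partial_sum u A = partial_sum v (B0 `|` B)%fset.
  by rewrite /= uE; apply: hB0; exact: fsubsetUl.
rewrite !partial_sumE; apply: (sum_pinj _ _ _ f) => // x y fxy.
rewrite inE; apply/idP/orP => [xA|[yB0|/BP[x' x'A fx'y]]].
- by right; apply/BP; exists x.
- by apply: (fsubsetP A0A); apply/A0P; exists y.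
- by rewrite (pinj_injective fxy fx'y).
Qed.

Lemma hilb_homP (R : realType) (H K : hilbertType R) (f g : hilb_hom H K) :
  f =1 g -> f = g.
Proof.
case: f g => [f fl fc] [g gl gc] /= /funext fg; subst g.
by rewrite (Prop_irrelevance fl gl) (Prop_irrelevance fc gc).
Qed.

Lemma hilb_dagger_unique (R : realType) (H K : hilbertType R)
    (f : hilb_hom H K) (g : hilb_hom K H) :
  is_adjoint f g -> g = hilb_dagger f.
Proof.
move=> fg; have fd : is_adjoint f (hilb_dagger f) := projT2 (cid (adjoint_exists f)).
apply: hilb_homP => psi; apply: hdot_inj => phi.
by rewrite hdotC -fg fd -hdotC.
Qed.

Lemma l2_map_adjoint (R : realType) (X Y : choiceType) (f : pinj X Y) :
  is_adjoint (l2_map R f) (l2_map R (pinj_dagger f)).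
Proof.
move=> phi psi; apply/esym/l2_dot_lim.
apply: (cvg_sum_pinj _ _ _ f _ _ _ _ _ _ (@l2_dot_cvg _ _ _ _)) => /=.
- move=> x y fxy.
  by rewrite (l2_map_funP _ fxy) (@l2_map_funP _ _ _ (pinj_dagger f) _ y x).
- by move=> x nf; rewrite l2_map_fun0 ?mulr0.
- by move=> y nf; rewrite l2_map_fun0 // rmorph0 mul0r.
Qed.

Theorem mainTheorem7 (R : realType) (X Y : choiceType) (f : pinj X Y) :
  l2_map R (pinj_dagger f) = hilb_dagger (l2_map R f) /\
  (forall (phi : l2 R X) (psi : l2 R Y),
     hdot (l2_map R f phi) psi = hdot phi (l2_map R (pinj_dagger f) psi)).
Proof.
split; last exact: l2_map_adjoint.
exact/hilb_dagger_unique/l2_map_adjoint.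
Qed.
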